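(* If $\kappa$ is an infinite cardinal with $2^{\kappa}<\aleph_\kappa$ and $\mathrm{cf}(\kappa)>\omega$, then there exists a compact Hausdorff space $X$ such that $o(X)=2^{\aleph_\kappa}=|X|$, $\aleph_\kappa \in \mathsf{C}^{*}(X)$, $\aleph_\kappa \notin \mathsf{WP}(X)$ and $\kappa\notin \mathsf{WP}^*(X)$.
   Context: For a topological space $X$, $\tau_X$ is its topology, $\tau_X^+=\tau_X\setminus\{\emptyset\}$, and $o(X)=|\tau_X|$. A family $\mathcal U\subseteq\tau_X^+$ is linked if any two of its members intersect. An infinite cardinal $\kappa$ is a weak precaliber for $X$ if for every indexed family $\{U_\alpha:\alpha<\kappa\}\subseteq\tau_X^+$ (repetitions allowed) there is $J\subseteq\kappa$ with $|J|=\kappa$ such that $\{U_\alpha:\alpha\in J\}$ is linked; $\mathsf{WP}(X)$ is the class of weak precalibers for $X$. An infinite cardinal $\kappa$ is a caliber* (resp. weak precaliber* ) for $X$ if for every set $\mathcal U\subseteq\tau_X^+$ with $|\mathcal U|=\kappa$ there is $\mathcal V\subseteq\mathcal U$ with $|\mathcal V|=\kappa$ and $\bigcap\mathcal V\neq\emptyset$ (resp. $\mathcal V$ linked); $\mathsf{C}^*(X)$ and $\mathsf{WP}^*(X)$ are the corresponding classes of infinite cardinals. $\aleph_\kappa$ denotes the cardinal of $\omega_\kappa$, with $\kappa$ regarded as an ordinal. *)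

(* Defs.v *)
From mathcomp Require Import all_boot all_order.
From mathcomp Require Import all_classical.
From mathcomp Require Export wochoice topology.

Set Implicit Arguments.
Unset Strict Implicit.
Unset Printing Implicit Defensive.

Local Open Scope classical_set_scope.
Local Open Scope card_scope.

(* Cardinals are represented by types (or subsets of types) and compared with
   the relations [#<=] and [#=] of mathcomp.classical.cardinality.  All the
   notions below depend on such a representative only up to bijection, except
   that a cardinal which is also used as an ordinal is represented by a type
   ordered as the corresponding initial ordinal. *)

Definition card_lt (T U : Type) (A : set T) (B : set U) : Prop :=
  A #<= B /\ ~ (B #<= A).

Definition infinite_type (T : Type) : Prop := infinite_set [set: T].

(* A well-ordered type in which every proper initial segment has strictly
   smaller cardinality. *)
Definition initial_ordinal (d : Order.disp_t) (K : orderType d) : Prop :=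
  well_order (fun x y : K => (x <= y)%O) /\
  forall k : K, card_lt [set x : K | (x < k)%O] [set: K].

Definition cofinal (d : Order.disp_t) (K : orderType d) (C : set K) : Prop :=
  forall k : K, exists2 c, C c & (k <= c)%O.

(* |C| = cf(K): C is a cofinal subset of least cardinality. *)
Definition is_cofinality (d : Order.disp_t) (K : orderType d) (C : set K) :
    Prop :=
  cofinal C /\ forall D : set K, cofinal D -> C #<= D.

(* |B| is the least infinite cardinal strictly above all |F i| with P i. *)
Definition least_infinite_above (I : Type) (P : set I) (F : I -> Type)
    (B : Type) : Prop :=
  [/\ infinite_type B,
      forall i, P i -> card_lt [set: F i] [set: B] &
      forall C : Type, infinite_type C ->
        (forall i, P i -> card_lt [set: F i] [set: C]) ->
        [set: B] #<= [set: C]].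

(* |A| = aleph_alpha, where alpha is the order type of the well-ordered type K.
   The family F is the sequence of the aleph_beta, beta < alpha; the zero,
   successor and limit clauses of the recursion are all instances of
   "aleph_beta is the least infinite cardinal greater than aleph_gamma for
   every gamma < beta". *)
Definition is_aleph (d : Order.disp_t) (K : orderType d) (A : Type) : Prop :=
  exists F : K -> Type,
    (forall k : K, least_infinite_above [set l : K | (l < k)%O] F (F k)) /\
    least_infinite_above [set: K] F A.

Section Topology.
Variable X : topologicalType.

Definition opens : set (set X) := [set U | open U].

Definition nonempty_opens : set (set X) := [set U | open U /\ U !=set0].

Definition linked (F : set (set X)) : Prop :=
  forall U V, F U -> F V -> U `&` V !=set0.

(* In the next three definitions the infinite cardinal is |I|. *)

Definition weak_precaliber (I : Type) : Prop :=
  infinite_type I /\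
  forall U : I -> set X, (forall i, nonempty_opens (U i)) ->
    exists2 J : set I, J #= [set: I] & linked (U @` J).

Definition caliber_star (I : Type) : Prop :=
  infinite_type I /\
  forall F : set (set X), F `<=` nonempty_opens -> F #= [set: I] ->
    exists G : set (set X),
      [/\ G `<=` F, G #= [set: I] & \bigcap_(V in G) V !=set0].

Definition weak_precaliber_star (I : Type) : Prop :=
  infinite_type I /\
  forall F : set (set X), F `<=` nonempty_opens -> F #= [set: I] ->
    exists G : set (set X),
      [/\ G `<=` F, G #= [set: I] & linked G].

End Topology.

Arguments opens : clear implicits.
Arguments nonempty_opens : clear implicits.

(* Main.v *)
Require Import Defs.
From mathcomp Require Import all_boot all_order.
From mathcomp Require Import all_classical.
From mathcomp Require Import topology.

(** The space is a disjoint sum of two compact spaces with opposite tasks.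
    Write A for aleph_K, and F k for the alephs below it.

    The first summand Y is the one-point compactification of the discrete space
    K. Its isolated points form a family of |K| pairwise disjoint open sets, so
    |K| is not a weak precaliber-star. Since A is a limit of the F k, there is a
    map from A to K each of whose fibers embeds into some F k
    ([exists_small_fibers]). Repeating the isolated point k along the fiber of k
    gives an A-indexed family in which a linked subfamily lives on a single
    fiber, so |A| is not a weak precaliber. The repetitions are essential: Y
    has at most 2^|K| < |A| open sets, so it cannot destroy caliber-star
    at A.

    The second summand is the cube 2^A. It has 2^|A| points, and an open subset
    is determined by the finite partial functions whose cylinders it contains,
    so it has at most 2^|A| open sets. It makes the sizes right, and it has A as a
    caliber in the strong, indexed sense ([cantor_cube_common_point]).

    Of |A| many open sets of the sum, at most 2^|K| miss the cube, and the
    caliber of the cube supplies a common point of |A| many of the others.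

    The caliber of the cube is the heart of the matter. Shrinking to cylinders,
    one is given |A| many finite partial functions and must find |A| many that
    are pairwise compatible; their union then extends to a common point. A is
    singular, so the delta-system argument is run twice.
    For each k in K, [exists_root] applied to the ideal of families of size at
    most |F k| gives a finite root E k and a large family B k whose members agree
    on E k, such that a coordinate outside E k is used by only |F k| many of
    them. Next, [exists_agreeing_of_complete] is applied to these roots,
    indexed by K, with the ideal of bounded sets of indices; this is where the
    uncountable cofinality of K enters, and it leaves cofinally many roots that are
    pairwise compatible. Finally a maximal compatible family, chosen by Zorn's
    lemma among the members that meet the roots only in their own root, is too large
    for every F k: otherwise some B k would still have a member to add
    ([exists_agreeing_singular]).

    The cardinal arithmetic all rests on |M * M| = |M| for infinite M
    ([card_square_le]). *)

Set Implicit Arguments.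
Unset Strict Implicit.
Unset Printing Implicit Defensive.

Import Order.TTheory.

Local Open Scope classical_set_scope.
Local Open Scope card_scope.

(** * Comparison of cardinals *)

Lemma inj_card_le_fun (T U : Type) (A : set T) (B : set U) (f : T -> U) :
  (forall x, A x -> B (f x)) ->
  (forall x y, A x -> A y -> f x = f y -> x = y) -> A #<= B.
Proof.
move=> fAB finj; apply/card_leP/injfunPex.
have h (x : A) : B (f (val x)) by apply: fAB; exact: set_valP.
exists (fun x : A => SigSub (mem_set (h x)) : B) => // x y _ _ [].
by move=> /finj e; apply/val_inj/e; exact: set_valP.
Qed.

Lemma card_le_fun (T U : Type) (u : U) (A : set T) (B : set U) : A #<= B ->
  exists2 f : T -> U, (forall x, A x -> B (f x)) &
    (forall x y, A x -> A y -> f x = f y -> x = y).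
Proof.
move=> /card_leP/injfunPex[f _ finj].
exists (fun x => if pselect (A x) is left Ax then val (f (SigSub (mem_set Ax))) else u).
  by move=> x Ax; case: pselect => // Ax'; exact: set_valP.
move=> x y Ax Ay; case: pselect => // Ax'; case: pselect => // Ay' /val_inj.
by move=> /finj e; have [] := e (mem_set I) (mem_set I).
Qed.

Lemma card_le_funT (T U : Type) :
  [set: T] #<= [set: U] <-> exists f : T -> U, injective f.
Proof.
split=> [|[f finj]]; last by apply: (inj_card_le_fun (f := f)) => // x y _ _ /finj.
have [[u _]|U0] := pselect (exists u : U, True).
  by move=> /(card_le_fun u)[f _ finj]; exists f => x y; exact: finj.
move=> /card_leP[f].
have absurd (t : T) : False.
  by apply: U0; exists (val (f (SigSub (mem_set (I : [set: T] t))))).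
by exists (fun t => False_rect U (absurd t)) => t.
Qed.

Lemma choice_on (T U : Type) (u : U) (A : set T) (R : T -> U -> Prop) :
  (forall x, A x -> exists y, R x y) ->
  exists f : T -> U, forall x, A x -> R x (f x).
Proof.
move=> h; suff /boolp.choice[f fR] : forall x, exists y, A x -> R x y by exists f.
move=> x; have [/h[y Rxy]|nAx] := pselect (A x); last by exists u.
by exists y.
Qed.

Lemma surj_card_le_fun (T U : Type) (A : set T) (B : set U) (f : U -> T) :
  (forall x, A x -> exists2 y, B y & f y = x) -> A #<= B.
Proof.
move=> h; apply: card_le_trans (card_image_le f B).
by apply: subset_card_le => x /h [y By <-]; exists y.
Qed.

(** By Zorn's lemma there is a maximal partial bijection between [A] and [B],
    encoded by its graph; it must exhaust one of the two sides. *)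
Lemma card_le_total (T U : Type) (A : set T) (B : set U) : A #<= B \/ B #<= A.
Proof.
pose P (G : set (T * U)) := (forall p, G p -> A p.1 /\ B p.2) /\
  forall p q, G p -> G q -> (p.1 = q.1 <-> p.2 = q.2).
have [F FP tot|G [[GAB Gbij] Gmax]] := @Zorn_bigcup _ P.
  split=> [p [X /FP[+ _] Xp]|p q [X FX Xp] [Y FY Yq]]; first exact.
  have [XY|YX] := tot _ _ FX FY; last by apply: (FP _ FX).2 => //; exact: YX.
  by apply: (FP _ FY).2 => //; exact: XY.
have [domA|] := pselect (forall x, A x -> exists y, G (x, y)).
  have [[b _]|B0] := pselect (exists b : U, True).
    left; have [f fG] := choice_on b domA.
    apply: (inj_card_le_fun (f := f)) => [x /fG/GAB[]//|x y /fG Gx /fG Gy].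
    by move=> /(Gbij _ _ Gx Gy).
  left; rewrite (_ : A = set0) ?card_ge0//; apply/seteqP; split=> // x /domA[y _].
  by apply: B0; exists y.
move=> /existsNP[x /not_implyP[Ax /forallNP xG]]; right.
suff domB y : B y -> exists x, G (x, y); last move=> By.
  have [f fG] := choice_on x domB.
  apply: (inj_card_le_fun (f := f)) => [y /fG/GAB[]//|y z /fG Gy /fG Gz].
  by move=> /(Gbij _ _ Gy Gz).
apply: contrapT => /forallNP yG.
apply: (Gmax (G `|` [set (x, y)])).
  split; first by move=> p Gp; left.
  by move=> /(_ (x, y)) h; apply: (xG y); apply: h; right.
split=> [p [/GAB//|-> //]|p q [Gp|->] [Gq|->]//=].
- exact: Gbij.
- case: p Gp => a b Gp /=; split=> e; rewrite e in Gp.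
    by case: (xG b).
  by case: (yG a).
- case: q Gq => a b Gq /=; split=> e; rewrite -e in Gq.
    by case: (xG b).
  by case: (yG a).
Qed.

Lemma card_ltP (T U : Type) (A : set T) (B : set U) :
  card_lt A B <-> ~ (B #<= A).
Proof. by split=> [[]//|h]; split=> //; have [|/h] := card_le_total A B. Qed.

(** * Infinite cardinal arithmetic *)

(** Among the infinite subsets X of M that carry an injection of X * X into X,
    Zorn's lemma provides a maximal one. If X embedded into its complement, the
    injection could be extended to X and a copy of X outside it; so by maximality
    the complement embeds into X instead, and M has the size of X. *)
Lemma card_square_le (M : Type) : infinite_type M -> [set: M * M] #<= [set: M].
Proof.
move=> /infiniteP/card_le_funT[g ginj].
(* Only the values of the function on X * X matter, so the order below is a
   preorder. *)
pose P (p : set M * (M * M -> M)) := [/\ [set: nat] #<= p.1,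
  forall x y, p.1 x -> p.1 y -> p.1 (p.2 (x, y)) &
  forall x y x' y', p.1 x -> p.1 y -> p.1 x' -> p.1 y' ->
    p.2 (x, y) = p.2 (x', y') -> (x, y) = (x', y')].
pose le (p q : {p | P p}) := `[< (sval p).1 `<=` (sval q).1 /\
  forall x y, (sval p).1 x -> (sval p).1 y -> (sval q).2 (x, y) = (sval p).2 (x, y) >].
have leP p q : reflect ((sval p).1 `<=` (sval q).1 /\
  forall x y, (sval p).1 x -> (sval p).1 y -> (sval q).2 (x, y) = (sval p).2 (x, y))
  (le p q) by exact: asboolP.
(* A copy of nat provides the starting point. *)
have [p0 _] : exists p : {p | P p}, True.
  have [c cinj] : exists c : nat * nat -> nat, injective c.
    by exists pickle; exact: (pcan_inj pickleK).
  have [r rg] := @choice_on M nat 0%N (range g) (fun x n => g n = x)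
    (fun x gx => let: ex_intro2 n _ e := gx in ex_intro _ n e).
  suff p0P : P (range g, fun q => g (c (r q.1, r q.2))) by exists (exist P _ p0P).
  split=> /=.
  - by apply: (inj_card_le_fun (f := g)) => // x y _ _ /ginj.
  - by move=> *; eexists.
  - move=> x y x' y' gx gy gx' gy' /ginj/cinj[ex ey].
    by rewrite -(rg x)// -(rg y)// ex ey !rg.
have [| | |[[X f] PX] maxX] := @ZL_preorder {p | P p} p0 le.
- by move=> p; apply/leP; split.
- move=> q p r /leP[pq epq] /leP[qr eqr]; apply/leP; split.
    by move=> x px; apply: qr; exact: pq.
  by move=> x y px py; rewrite eqr ?epq//; exact: pq.
- move=> F Ftot; have [[q Fq]|F0] := pselect (exists q, F q); last first.
    by exists p0 => s Fs; case: F0; exists s.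
  pose X := \bigcup_(p in F) (sval p).1.
  have common x y : X x -> X y -> exists p, [/\ F p, (sval p).1 x & (sval p).1 y].
    move=> [s Fs sx] [t Ft ty].
    have [/leP[st _]|/leP[ts _]] := Ftot _ _ Fs Ft.
      by exists t; split=> //; exact: st.
    by exists s; split=> //; exact: ts.
  have [h hP] := @choice_on (M * M) M (g 0%N) [set q | X q.1 /\ X q.2]
    (fun q z => exists p, [/\ F p, (sval p).1 q.1, (sval p).1 q.2 & (sval p).2 q = z])
    (fun q Xq => let: ex_intro p (And3 Fp px py) := common _ _ Xq.1 Xq.2 in
      ex_intro _ _ (ex_intro _ p (And4 Fp px py erefl))).
  have hE p x y : F p -> (sval p).1 x -> (sval p).1 y -> h (x, y) = (sval p).2 (x, y).
    move=> Fp px py.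
    have [|s [/= Fs sx sy <-]] := hP (x, y); first by split; exists p.
    have [/leP[_ e]|/leP[_ e]] := Ftot _ _ Fp Fs; first by rewrite e.
    by rewrite e.
  have common4 x y x' y' : X x -> X y -> X x' -> X y' ->
      exists p, [/\ F p, (sval p).1 x /\ (sval p).1 y & (sval p).1 x' /\ (sval p).1 y'].
    move=> Xx Xy Xx' Xy'.
    have [s [Fs sx sy]] := common _ _ Xx Xy; have [t [Ft tx ty]] := common _ _ Xx' Xy'.
    have [/leP[st _]|/leP[ts _]] := Ftot _ _ Fs Ft.
      by exists t; split=> //; split; exact: st.
    by exists s; split=> //; split; exact: ts.
  have PXh : P (X, h).
    split=> /=.
    - apply: (@card_le_trans _ _ _ (sval q).1); first by have [] := svalP q.
      by apply: subset_card_le => x qx; exists q.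
    - move=> x y Xx Xy; have [p [Fp px py]] := common _ _ Xx Xy.
      by rewrite (hE p)//; exists p => //; have [_ + _] := svalP p; exact.
    - move=> x y x' y' Xx Xy Xx' Xy'.
      have [p [Fp [px py] [px' py']]] := common4 _ _ _ _ Xx Xy Xx' Xy'.
      by rewrite !(hE p)//; have [_ _ +] := svalP p; exact.
  exists (exist P _ PXh) => p Fp; apply/leP => /=; split.
    by move=> x px; exists p.
  by move=> x y px py; exact: hE.
have [Xinf fX finj] := PX; rewrite /= in Xinf fX finj.
have [e eXT einj] := card_le_fun (g 0%N) Xinf.
have eX n : X (e n) by exact: eXT.
have e01 : e 0%N <> e 1%N by move=> /einj => /(_ I I).
(* It remains to embed M into X. *)
suff /(card_le_fun (g 0%N))[j jX jinj] : [set: M] #<= X.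
  apply/card_le_funT; exists (fun q => f (j q.1, j q.2)) => -[x y] [x' y'] /= E.
  by case: (finj _ _ _ _ (jX x I) (jX y I) (jX x' I) (jX y' I) E) => /jinj-> // /jinj->.
have [XCX|XXC] := card_le_total (~` X) X.
  have [h hX hinj] := card_le_fun (g 0%N) XCX.
  apply: (inj_card_le_fun
      (f := fun x => if pselect (X x) then f (e 0%N, x) else f (e 1%N, h x))).
    move=> x _; case: pselect => Xx; apply: fX => //; try exact: eX.
    exact: hX.
  move=> x y _ _; case: pselect => Xx; case: pselect => Xy E.
  - by case: (finj _ _ _ _ (eX _) Xx (eX _) Xy E).
  - by case: (finj _ _ _ _ (eX _) Xx (eX _) (hX _ Xy) E) => /e01.
  - by case: (finj _ _ _ _ (eX _) (hX _ Xx) (eX _) Xy E) => /esym/e01.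
  - by case: (finj _ _ _ _ (eX _) (hX _ Xx) (eX _) (hX _ Xy) E) => /hinj->.
(* Otherwise X has a copy Y outside itself, and the pairing extends to X u Y. *)
have [h hX hinj] := card_le_fun (g 0%N) XXC.
pose Y := h @` X; pose Z := X `|` Y.
have [r rY] := @choice_on M M (g 0%N) Y (fun y x => X x /\ h x = y)
  (fun y hy => let: ex_intro2 x Xx hxy := hy in ex_intro _ x (conj Xx hxy)).
pose u z := if pselect (X z) then f (e 0%N, z) else f (e 1%N, r z).
have ZX z : Z z -> X (u z).
  rewrite /u; case: pselect => [Xz _|nXz [//|/rY[Xr _]]]; apply: fX => //; exact: eX.
have uinj z z' : Z z -> Z z' -> u z = u z' -> z = z'.
  move=> Zz Zz'; rewrite /u; case: pselect => Xz; case: pselect => Xz' E.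
  - by case: (finj _ _ _ _ (eX _) Xz (eX _) Xz' E).
  - case: Zz' => // /rY[Xr _].
    by case: (finj _ _ _ _ (eX _) Xz (eX _) Xr E) => /e01.
  - case: Zz => // /rY[Xr _].
    by case: (finj _ _ _ _ (eX _) Xr (eX _) Xz' E) => /esym/e01.
  - case: Zz => // /rY[Xr hr]; case: Zz' => // /rY[Xr' hr'].
    case: (finj _ _ _ _ (eX _) Xr (eX _) Xr' E) => rr.
    by rewrite -hr -hr' rr.
(* [u] injects X u Y into X, so the new pairs can be coded first in X and then,
   through [h], in Y, away from the codes already in use. *)
pose F q := if pselect (X q.1 /\ X q.2) then f q else h (f (u q.1, u q.2)).
have PZ : P (Z, F).
  split=> /=.
  - by apply: card_le_trans Xinf _; apply: subset_card_le; exact: subsetUl.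
  - move=> x y Zx Zy; rewrite /F; case: pselect => [[Xx Xy]|_] /=.
      by left; exact: fX.
    by right; eexists; last reflexivity; apply: fX; exact: ZX.
  - move=> x y x' y' Zx Zy Zx' Zy'; rewrite /F.
    case: pselect => [[Xx Xy]|nX] /=; case: pselect => [[Xx' Xy']|nX'] /=.
    + exact: finj.
    + move=> E; suff : (~` X) (f (x, y)) by case; exact: fX.
      by rewrite E; apply: hX; apply: fX; exact: ZX.
    + move=> E; suff : (~` X) (f (x', y')) by case; exact: fX.
      by rewrite -E; apply: hX; apply: fX; exact: ZX.
    + have [ux uy ux' uy'] := And4 (ZX _ Zx) (ZX _ Zy) (ZX _ Zx') (ZX _ Zy').
      move=> /(hinj _ _ (fX _ _ ux uy) (fX _ _ ux' uy')) E.
      case: (finj _ _ _ _ ux uy ux' uy' E).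
      by move=> /uinj -> // /uinj ->.
have /leP[/= ZsubX _] : le (exist P _ PZ) (exist P _ PX).
  apply: maxX; apply/leP => /=; split; first exact: subsetUl.
  by move=> x y Xx Xy; rewrite /F; case: pselect => // -[].
have Xe : X (e 0%N) by exact: eX.
by case: (hX (e 0%N) Xe); apply: ZsubX; right; exists (e 0%N).
Qed.

Lemma card_bigcup_le (M U T : Type) (S : set U) (G : U -> set T) :
  infinite_type M -> S #<= [set: M] -> (forall s, S s -> G s #<= [set: M]) ->
  \bigcup_(s in S) G s #<= [set: M].
Proof.
move=> Minf SM GM.
have [m _] := infinite_setN0 Minf.
have [u|S0] := pselect (S !=set0); last first.
  rewrite (_ : bigcup _ _ = set0) ?card_ge0//.
  by apply/seteqP; split=> // x [s Ss _]; apply: S0; exists s.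
have [v _] := u.
have [f _ finj] := card_le_fun m SM.
have [g gP] := @choice_on U (T -> M) (fun=> m) S
  (fun s h => forall x y, G s x -> G s y -> h x = h y -> x = y)
  (fun s Ss => let: ex_intro2 h _ hinj := card_le_fun m (GM s Ss) in ex_intro _ h hinj).
have [i iP] := @choice_on T U v (\bigcup_(s in S) G s) (fun x s => S s /\ G s x)
  (fun x h => let: ex_intro2 s Ss Gx := h in ex_intro _ s (conj Ss Gx)).
apply: card_le_trans (card_square_le Minf).
apply: (inj_card_le_fun (f := fun x => (f (i x), g (i x) x))) => // x y.
move=> /iP[Sx Gx] /iP[Sy Gy] [/(finj _ _ Sx Sy) ixy gxy].
by apply: (gP _ Sy) => //; rewrite -ixy // {2}ixy.
Qed.

Lemma card_nat_le (M : Type) (S : set nat) : infinite_type M -> S #<= [set: M].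
Proof. by move=> /infiniteP; apply: card_le_trans; exact: card_leT. Qed.

Lemma card_setU_le (M T : Type) (B C : set T) : infinite_type M ->
  B #<= [set: M] -> C #<= [set: M] -> B `|` C #<= [set: M].
Proof.
move=> Minf BM CM.
have -> : B `|` C = \bigcup_(b in [set: bool]) (if b then B else C).
  apply/seteqP; split=> x; last by case=> -[] _ ?; [left|right].
  by case=> ?; [exists true|exists false].
apply: card_bigcup_le => // [|[]//].
apply: card_le_trans (card_nat_le setT Minf).
by apply/card_le_funT; exists nat_of_bool; case; case.
Qed.

Lemma card_finite_le (M T : Type) (B : set T) : infinite_type M ->
  finite_set B -> B #<= [set: M].
Proof.
move=> Minf [n]; move/card_eqPle => [Bn _].
exact: card_le_trans Bn (card_nat_le _ Minf).
Qed.

Lemma infinite_type_le (M N : Type) : infinite_type M -> [set: M] #<= [set: N] ->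
  infinite_type N.
Proof. by move=> Minf MN; apply: contra_not Minf; exact: card_le_finite. Qed.

Lemma card_prod_le (M T U : Type) : infinite_type M -> [set: T] #<= [set: M] ->
  [set: U] #<= [set: M] -> [set: T * U] #<= [set: M].
Proof.
move=> Minf /card_le_funT[f finj] /card_le_funT[g ginj].
apply: card_le_trans (card_square_le Minf).
apply/card_le_funT; exists (fun p => (f p.1, g p.2)).
by move=> [x y] [x' y'] [/finj-> /ginj->].
Qed.

Lemma card_seq_le (M : Type) : infinite_type M -> [set: seq M] #<= [set: M].
Proof.
move=> Minf; have [c cinj] := (card_le_funT _ _).1 (card_square_le Minf).
have [m _] := infinite_setN0 Minf.
apply: card_le_trans (card_prod_le Minf (card_nat_le setT Minf) (card_lexx _)).
(* Nested pairing is injective only between sequences of the same length. *)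
pose code := foldr (fun x y => c (x, y)) m.
apply/card_le_funT; exists (fun s => (size s, code s)) => s t [].
by elim: s t => [|x s IH] [|y t]//= [st] /cinj[-> /(IH _ st)->].
Qed.

Lemma infinite_powerset (M : Type) : infinite_type M -> infinite_type (set M).
Proof.
move=> Minf; apply: infinite_type_le Minf _; apply/card_le_funT.
by exists set1 => x y /seteqP[/(_ x erefl)].
Qed.

Lemma card_powerset_le (M N : Type) : [set: M] #<= [set: N] ->
  [set: set M] #<= [set: set N].
Proof.
move=> /card_le_funT[f finj]; apply/card_le_funT.
exists (fun B => f @` B) => B C BC; apply/seteqP; split=> x Bx.
  have [y Cy /finj <-] // : (f @` C) (f x) by rewrite -BC; exists x.
have [y Cy /finj <-] // : (f @` B) (f x) by rewrite BC; exists x.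
Qed.

Lemma card_option_le (M : Type) : infinite_type M -> [set: option M] #<= [set: M].
Proof.
move=> Minf; have -> : [set: option M] = some @` setT `|` [set None].
  by apply/seteqP; split=> // -[x|] _; [left; exists x|right].
apply: card_setU_le => //; first exact: card_image_le.
exact/card_finite_le/finite_set1.
Qed.

(** * Delta-systems and compatible finite partial functions *)

(** Applied with compatibility for [R], this replaces the transfinite
    recursions of the usual delta-system arguments. *)
Lemma maximal_independent (I : Type) (R : I -> I -> Prop) (Z : set I) :
  (forall i, R i i) -> (forall i j, R i j -> R j i) ->
  exists J, [/\ J `<=` Z, forall i j, J i -> J j -> R i j &
    forall i, Z i -> ~ J i -> exists2 j, J j & ~ R i j].
Proof.
move=> Rxx Rsym.
pose P J := J `<=` Z /\ forall i j, J i -> J j -> R i j.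
have [F FP tot|J [[JZ JR] Jmax]] := @Zorn_bigcup _ P.
  split=> [i [X /FP[+ _] Xi]|i j [X FX Xi] [Y FY Yj]]; first exact.
  have [XY|YX] := tot _ _ FX FY; last by apply: (FP _ FX).2 => //; exact: YX.
  by apply: (FP _ FY).2 => //; exact: XY.
exists J; split=> // i Zi Ji; apply: contrapT => /forall2NP h.
have {}h j : J j -> R i j by move=> Jj; have [//|/contrapT] := h j.
apply: (Jmax (J `|` [set i])).
  by split=> [j Jj|JJ]; [left|apply/Ji/JJ; right].
split=> [j [/JZ//|->//]|j k [Jj|->] [Jk|->]].
- exact: JR.
- exact/Rsym/h.
- exact: h.
- exact: Rxx.
Qed.

Record sigma_ideal (I : Type) (small : set (set I)) : Prop := SigmaIdeal {
  small_set0 : small set0;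
  small_sub : forall A B, A `<=` B -> small B -> small A;
  small_bigcup : forall G : nat -> set I,
    (forall n, small (G n)) -> small (\bigcup_n G n) }.

Section SigmaIdeal.
Context (I : Type) (small : set (set I)) (smallP : sigma_ideal small).

Lemma small_setU (A B : set I) : small A -> small B -> small (A `|` B).
Proof.
move=> sA sB; pose G n := if n is 0 then A else B.
apply: (small_sub smallP (B := \bigcup_n G n)).
  by move=> x [Ax|Bx]; [exists 0%N|exists 1%N].
by apply: (small_bigcup smallP) => -[].
Qed.

Lemma small_seq (A : eqType) (s : seq A) (G : A -> set I) :
  (forall a, a \in s -> small (G a)) ->
  small [set i | exists2 a, a \in s & G a i].
Proof.
elim: s => [|a s IH] h.
  by apply: (small_sub smallP) (small_set0 smallP) => i [].
apply: (small_sub smallP) (small_setU (h a (mem_head _ _)) (IH _)).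
  move=> i [b]; rewrite inE => /predU1P[->|bs] Gi; [by left|right].
  by exists b.
by move=> b bs; apply: h; rewrite inE bs orbT.
Qed.

Context (A : eqType) (x : I -> A -> bool) (D : I -> seq A).

(** The pair [x i], [D i] stands for the finite partial function that is [x i]
    restricted to [D i]; agreement is compatibility of partial functions. *)
Definition agree i j := forall a, a \in D i -> a \in D j -> x i a = x j a.

(** A delta-system up to smallness. By countable completeness one may assume
    that all [D i] have the same size; then a set E of maximal size that is
    contained in non-small many [D i], with fixed values on it, is a root,
    since any coordinate outside E occurring in non-small many of these
    could be added to E. *)
Lemma exists_root (Z : set I) : ~ small Z -> exists (E : seq A) i0 B,
  [/\ B `<=` Z, ~ small B, forall i a, B i -> a \in E -> x i a = x i0 a &
    forall a, a \notin E -> small (B `&` [set i | a \in D i])].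
Proof.
move=> Zns.
have [n nsn] : exists n, ~ small (Z `&` [set i | size (D i) = n]).
  apply/existsNP => h; apply: Zns; apply: (small_sub smallP) (small_bigcup smallP h).
  by move=> i Zi; exists (size (D i)).
apply: contrapT => noroot.
suff step m : exists (E : seq A) i0 B, [/\ uniq E /\ size E = m,
    B `<=` Z `&` [set i | size (D i) = n], ~ small B &
    forall i a, B i -> a \in E -> a \in D i /\ x i a = x i0 a].
  have [E [i0 [B [[Eu Es] BZ Bns BE]]]] := step n.+1.
  have [i Bi] : B !=set0.
    apply/set0P/eqP => B0; apply: Bns; rewrite B0; exact: small_set0.
  have := uniq_leq_size Eu (fun a aE => (BE i a Bi aE).1).
  by rewrite Es (BZ i Bi).2 ltnn.
elim: m => [|m [E [i0 [B [[Eu Es] BZ Bns BE]]]]].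
  have [i _] : (Z `&` [set i | size (D i) = n]) !=set0.
    apply/set0P/eqP => Z0; apply: nsn; rewrite Z0; exact: small_set0.
  by exists [::], i, (Z `&` [set i | size (D i) = n]); split.
have [a aE Bans] : exists2 a, a \notin E & ~ small (B `&` [set i | a \in D i]).
  apply: contrapT => /forall2NP h; apply: noroot; exists E, i0, B; split=> //.
  - by move=> i /BZ[].
  - by move=> i b Bi /(BE _ _ Bi)[].
  - by move=> b bE; have [//|/contrapT] := h b.
(* There are only two values at [a], so one of them is taken by a non-small set. *)
have [b Bbns] : exists b, ~ small (B `&` [set i | a \in D i /\ x i a = b]).
  apply/existsNP => h; apply: Bans.
  apply: (small_sub smallP) (small_setU (h true) (h false)) => i [Bi /= ai].
  by case xia: (x i a); [left|right].
have [i1 [Bi1 [ai1 xi1]]] : B `&` [set i | a \in D i /\ x i a = b] !=set0.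
  apply/set0P/eqP => B0; apply: Bbns; rewrite B0; exact: small_set0.
exists (a :: E), i1, (B `&` [set i | a \in D i /\ x i a = b]); split=> //.
- by rewrite /= aE Eu Es.
- by move=> i [/BZ].
- move=> i c [Bi [ai xi]]; rewrite inE => /predU1P[->|cE]; first by rewrite xi xi1.
  by have [-> ->] := BE _ _ Bi cE; have [_ ->] := BE _ _ Bi1 cE.
Qed.

(** The case of a regular cardinal: the hypothesis says that small unions of
    small sets are small. Take a maximal agreeing family inside the [B] of a
    root. If it were small, so would be the set of indices that share with one of
    its members a coordinate outside the root; any other index of [B] could
    be added to it. *)
Lemma exists_agreeing_of_complete (Z : set I) : ~ small Z ->
  (forall J (G : I -> set I), J `<=` Z -> small J -> (forall j, J j -> small (G j)) ->
    small (\bigcup_(j in J) G j)) ->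
  exists J, [/\ J `<=` Z, ~ small J & forall i j, J i -> J j -> agree i j].
Proof.
move=> /exists_root[E [i0 [B [BZ Bns BE Bsm]]]] complete.
have [//|i j ag a aj ai|J [JB Jag Jmax]] := @maximal_independent I agree B.
  by rewrite ag.
exists J; split=> //; first exact: subset_trans BZ.
move=> Jsm.
pose G j := B `&` [set i | exists2 a, a \in D j & a \notin E /\ a \in D i].
have Gsm j : small (G j).
  apply: (small_sub smallP) (@small_seq _ [seq a <- D j | a \notin E]
    (fun a => B `&` [set i | a \in D i]) _).
    move=> i [Bi [a aj [aE ai]]]; exists a => //.
    by rewrite mem_filter aE.
  by move=> a; rewrite mem_filter => /andP[/Bsm].
apply: Bns; apply: (small_sub smallP)
  (small_setU Jsm (complete J G _ Jsm (fun j _ => Gsm j))); last first.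
  exact: subset_trans BZ.
move=> i Bi; have [Ji|/(Jmax _ Bi)[j Jj nag]] := pselect (J i); first by left.
right; exists j => //; split=> //; apply: contrapT => h; apply: nag => a ai aj.
have [aE|aE] := boolP (a \in E); first by rewrite !BE//; exact: JB.
by case: h; exists a.
Qed.

End SigmaIdeal.

Lemma card_le_sigma_ideal (M I : Type) : infinite_type M ->
  sigma_ideal (fun S : set I => S #<= [set: M]).
Proof.
move=> Minf; split; first exact: card_ge0.
  by move=> A B /subset_card_le; exact: card_le_trans.
move=> G Gsm; apply: card_bigcup_le => //; exact: card_nat_le.
Qed.

(** The case of a singular cardinal, the limit of the [F k]. [T] is a cofinal set
    of levels to which the regular case applies; [k0] is a level from which on
    unions over all levels are harmless. *)
Lemma exists_agreeing_singular (d : Order.disp_t) (K : orderType d)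
    (F : K -> Type) (k0 : K) (T : set K) (I : Type) (A : eqType)
    (x : I -> A -> bool) (D : I -> seq A) (Z : set I) :
  (forall k, infinite_type (F k)) ->
  (forall k l, (k <= l)%O -> [set: F k] #<= [set: F l]) ->
  [set: K] #<= [set: F k0] ->
  sigma_ideal (fun S : set K => ~ cofinal S) ->
  cofinal T ->
  (forall J (G : K -> set K), J `<=` T -> ~ cofinal J ->
    (forall j, J j -> ~ cofinal (G j)) -> ~ cofinal (\bigcup_(j in J) G j)) ->
  (forall k, ~ (Z #<= [set: F k])) ->
  exists J, [/\ J `<=` Z, forall k, ~ (J #<= [set: F k]) &
    forall i j, J i -> J j -> agree x D i j].
Proof.
move=> Finf Fmono KF0 bddP Tcof complete Zbig.
have [r rP] : exists r : K -> seq A * I * set I, forall k,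
    let: (E, i0, B) := r k in
    [/\ B `<=` Z, ~ (B #<= [set: F k]),
       forall i a, B i -> a \in E -> x i a = x i0 a &
       forall a, a \notin E -> B `&` [set i | a \in D i] #<= [set: F k]].
  suff /boolp.choice[r rP] : forall k, exists r : seq A * I * set I,
    let: (E, i0, B) := r in
    [/\ B `<=` Z, ~ (B #<= [set: F k]),
       forall i a, B i -> a \in E -> x i a = x i0 a &
       forall a, a \notin E -> B `&` [set i | a \in D i] #<= [set: F k]].
    by exists r.
  move=> k; have [E [i0 [B h]]] :=
    exists_root (card_le_sigma_ideal I (Finf k)) x D (Zbig k).
  by exists (E, i0, B).
pose E k := (r k).1.1; pose y k := x (r k).1.2; pose B k := (r k).2.
have {}rP k : [/\ B k `<=` Z, ~ (B k #<= [set: F k]),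
       forall i a, B k i -> a \in E k -> x i a = y k a &
       forall a, a \notin E k -> B k `&` [set i | a \in D i] #<= [set: F k]].
  by rewrite /B /E /y; have := rP k; case: (r k) => -[].
have BZ k : B k `<=` Z by have [] := rP k.
have Bbig k : ~ (B k #<= [set: F k]) by have [] := rP k.
have By k i a : B k i -> a \in E k -> x i a = y k a by have [_ _ + _] := rP k; apply.
have Bsm k a : a \notin E k -> B k `&` [set i | a \in D i] #<= [set: F k].
  by have [_ _ _] := rP k; apply.
have [T' [_ /contrapT T'cof T'ag]] :=
  exists_agreeing_of_complete bddP y E (fun h => h Tcof) complete.
(* The items that meet the chosen roots only inside their own root. *)
pose X := [set i | exists k, [/\ T' k, B k i &
  forall l a, T' l -> a \in E l -> a \in D i -> a \in E k]].
have [//|i j ag a aj ai|J [JX Jag Jmax]] := @maximal_independent I (agree x D) X.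
  by rewrite ag.
exists J; split=> // [i /JX[k [_ /BZ]]//|k Jsm].
have [c T'c kc] := T'cof (Order.max k k0).
have {}Jsm : J #<= [set: F c].
  by apply: card_le_trans Jsm (Fmono _ _ _); rewrite (le_trans _ kc)// le_max lexx.
have KFc : [set: K] #<= [set: F c].
  by apply: card_le_trans KF0 (Fmono _ _ _); rewrite (le_trans _ kc)// le_max lexx orbT.
(* The new item is sought in [B c]: it must lie outside [J], and its
   coordinates outside [E c] must avoid the roots and the members of [J]. *)
pose meets (s : seq A) := B c `&`
  [set i | exists2 a, a \in s & a \notin E c /\ a \in D i].
have smallP := card_le_sigma_ideal I (Finf c).
have meets_small s : meets s #<= [set: F c].
  apply: (small_sub smallP) (@small_seq _ _ smallP _ [seq a <- s | a \notin E c]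
    (fun a => B c `&` [set i | a \in D i]) _).
    move=> i [Bi [a aj [aE ai]]]; exists a => //.
    by rewrite mem_filter aE.
  by move=> a; rewrite mem_filter => /andP[/Bsm].
apply: (Bbig c); apply: (small_sub smallP) (small_setU smallP
  (small_setU smallP Jsm (card_bigcup_le (G := fun j => meets (D j)) (Finf c) Jsm _))
  (card_bigcup_le (G := fun l => meets (E l)) (Finf c) KFc _)) => //.
move=> i Bi; have [Ji|nJi] := pselect (J i); first by left; left.
have [Xi|nXi] := pselect (X i); last first.
  right; apply: contrapT => h; apply: nXi; exists c; split=> // l a T'l al ai.
  by apply: contrapT => /negP aE; apply: h; exists l => //; split=> //; exists a.
left; right; have [j Jj nag] := Jmax i Xi nJi.
exists j => //; split=> //; apply: contrapT => h; apply: nag => a ai aj.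
have [aE|aE] := boolP (a \in E c); last by case: h; exists a.
have [l [T'l Bj /(_ c a T'c aE aj) al]] := JX _ Jj.
by rewrite (By c)// (By l _ _ Bj al); exact: T'ag.
Qed.

(** * Cofinality and the aleph hierarchy *)

Section InitialOrdinal.
Context (d : Order.disp_t) (K : orderType d).
Hypotheses (K_card : initial_ordinal K) (K_infinite : infinite_type K).

Lemma exists_least (S : set K) : S !=set0 ->
  exists2 m, S m & forall x, S x -> (m <= x)%O.
Proof.
move=> [x Sx]; have [|m [[Sm mlow] _]] := K_card.1 (fun x => `[< S x >]).
  by exists x; exact/asboolP.
by exists m => [|y Sy]; [exact/asboolP|apply: mlow; exact/asboolP].
Qed.

(** Otherwise [K] would have one element more than a proper initial segment,
    hence the same size. *)
Lemma exists_gt (k : K) : exists l, (k < l)%O.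
Proof.
apply: contrapT => /forallNP h.
have K_le : [set: K] = [set l | (l < k)%O] `|` [set k].
  apply/seteqP; split=> // l _; have := h l; move/negP; rewrite -leNgt le_eqVlt.
  by move=> /predU1P[->|]; [right|left].
have [] := K_card.2 k => _; apply; rewrite {1}K_le.
have /card_eqPle[_ le_lt] := card_setT [set l | (l < k)%O].
have lt_inf : infinite_type [set l | (l < k)%O].
  move=> lt_fin; apply: K_infinite; rewrite K_le finite_setU; split.
    exact: card_le_finite le_lt lt_fin.
  exact: finite_set1.
have /card_eqPle[lt_le _] := card_setT [set l | (l < k)%O].
apply: card_le_trans lt_le; apply: card_setU_le => //.
by apply: card_finite_le => //; exact: finite_set1.
Qed.

Lemma not_cofinalP (S : set K) : ~ cofinal S <-> exists m, forall k, S k -> (k < m)%O.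
Proof.
split=> [/existsNP[m /forall2NP h]|[m h] /(_ m)[k /h km]].
  by exists m => k Sk; rewrite ltNge; apply/negP => mk; case: (h k).
by rewrite leNgt km.
Qed.

Context (C : set K).
Hypothesis C_cof : is_cofinality C.

(** Regularity of the cofinality: the bounds of the [G s] are too few to be
    cofinal. *)
Lemma not_cofinal_bigcup (I : Type) (S : set I) (G : I -> set K) :
  card_lt S C -> (forall s, S s -> ~ cofinal (G s)) ->
  ~ cofinal (\bigcup_(s in S) G s).
Proof.
move=> [_ SC] Gbdd.
have [k _] := infinite_setN0 K_infinite.
have [b bP] := choice_on k (fun s Ss => (not_cofinalP (G s)).1 (Gbdd s Ss)).
have [/C_cof.2 CS|/not_cofinalP[m bm]] := pselect (cofinal (b @` S)).
  by case: SC; exact: card_le_trans CS (card_image_le _ _).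
apply/not_cofinalP; exists m => l [s Ss Gl].
by apply: lt_trans (bP s Ss l Gl) _; apply: bm; exists s.
Qed.

Lemma not_cofinal_sigma_ideal : card_lt [set: nat] C ->
  sigma_ideal (fun S : set K => ~ cofinal S).
Proof.
move=> cof_gt; split.
- have [k _] := infinite_setN0 K_infinite.
  by apply/not_cofinalP; exists k.
- by move=> A B AB /not_cofinalP[m h]; apply/not_cofinalP; exists m => k /AB/h.
- by move=> G Gbdd; apply: not_cofinal_bigcup cof_gt _ => n _.
Qed.

(** [C] itself may have large bounded subsets. Enumerate it along the initial
    segment W of [K] that has the order type of the cardinal of [C], and keep the
    records, that is, the values larger than all previous ones. *)
Lemma exists_thin_cofinal : exists2 T : set K, cofinal T &
  forall S, S `<=` T -> ~ cofinal S -> card_lt S C.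
Proof.
have [k0 _] := infinite_setN0 K_infinite.
pose W := [set x : K | card_lt [set y : K | (y < x)%O] C].
have CW : C #<= W.
  have [WT|/existsNP/exists_least[k kW kmin]] := pselect (forall x, W x).
    by apply: subset_card_le => x _; exact: WT.
  apply: (@card_le_trans _ _ _ [set y : K | (y < k)%O]).
    by apply: contrapT => /card_ltP.
  apply: subset_card_le => y /= yk; apply: contrapT => /kmin.
  by rewrite leNgt yk.
have [f fW finj] := card_le_fun k0 CW.
have [e eP] := @choice_on K K k0 (f @` C) (fun w c => C c /\ f c = w)
  (fun w h => let: ex_intro2 c Cc fc := h in ex_intro _ c (conj Cc fc)).
have ef c : C c -> e (f c) = c.
  move=> Cc; have [|Cefc efc] := eP (f c); first by exists c.
  exact: finj.
exists [set e w | w in [set w | W w /\ forall v, W v -> (v < w)%O -> (e v < e w)%O]].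
  move=> k; have [c Cc kc] := C_cof.1 k.
  have [|w [Ww kw] wmin] := @exists_least [set w | W w /\ (k <= e w)%O].
    by exists (f c); split; [exact: fW|rewrite ef].
  exists (e w) => //; exists w => //; split=> // v Wv vw.
  apply: lt_le_trans kw; rewrite ltNge; apply/negP => kv.
  by have := wmin v (conj Wv kv); rewrite leNgt vw.
move=> S ST /not_cofinalP[m Sm].
have [c Cc mc] := C_cof.1 m.
have [|w0 [Ww0 mw0] _] := @exists_least [set w | W w /\ (m <= e w)%O].
  by exists (f c); split; [exact: fW|rewrite ef].
suff S_le : S #<= [set w | (w < w0)%O].
  apply/card_ltP => CS; apply: (Ww0.2); exact: card_le_trans CS S_le.
apply: (surj_card_le_fun (f := e)) => s Ss; have [w [Ww wrec] ew] := ST _ Ss.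
exists w => //=; rewrite ltNge; apply/negP => w0w.
have : (m <= e w)%O.
  move: w0w; rewrite le_eqVlt => /predU1P[<-//|/(wrec _ Ww0)].
  by move=> /(le_lt_trans mw0)/ltW.
by rewrite leNgt ew Sm.
Qed.

End InitialOrdinal.

Section Aleph.
Context (d : Order.disp_t) (K : orderType d) (F : K -> Type) (A : Type).
Hypotheses (K_card : initial_ordinal K) (K_infinite : infinite_type K).
Hypothesis F_aleph : forall k, least_infinite_above [set l : K | (l < k)%O] F (F k).
Hypothesis A_aleph : least_infinite_above [set: K] F A.

Lemma aleph_le k l : (k <= l)%O -> [set: F k] #<= [set: F l].
Proof.
rewrite le_eqVlt => /predU1P[->|kl]; first exact: card_lexx.
by have [_ /(_ k kl)[]] := F_aleph l.
Qed.

Lemma aleph_infinite k : infinite_type (F k).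
Proof. by have [] := F_aleph k. Qed.

Lemma aleph_leS k l : (k < l)%O -> ~ ([set: F l] #<= [set: F k]).
Proof. by move=> kl; have [_ /(_ k kl)[]] := F_aleph l. Qed.

Lemma aleph_limit (I : Type) (J : set I) : (forall k, ~ (J #<= [set: F k])) ->
  [set: A] #<= J.
Proof.
move=> Jbig; have /card_eqPle[JJ J_le] := card_setT J.
have [_ _ Amin] := A_aleph; apply: card_le_trans JJ; apply: Amin.
  have [k _] := infinite_setN0 K_infinite.
  move=> Jfin; apply: (Jbig k); apply: card_le_trans J_le _.
  apply: card_finite_le => //; exact: aleph_infinite.
by move=> k _; apply/card_ltP => JF; apply: (Jbig k); exact: card_le_trans J_le JF.
Qed.

Lemma aleph_not_le k : ~ ([set: A] #<= [set: F k]).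
Proof. by have [_ /(_ k I)[]] := A_aleph. Qed.

Lemma card_lt_aleph (I : Type) (J : set I) : card_lt J [set: A] ->
  exists k, J #<= [set: F k].
Proof. by move=> [_ AJ]; apply: contrapT => /forallNP/aleph_limit. Qed.

(** The alephs strictly increase, so the disjoint union of the [F k] exceeds
    each of them and therefore embeds [A]. *)
Lemma exists_small_fibers : exists g : A -> K,
  forall k, [set a | g a = k] #<= [set: F k].
Proof.
have : [set: A] #<= [set: {k & F k}].
  apply: aleph_limit => k; have [l kl] := exists_gt K_card K_infinite k.
  move=> h; apply: (aleph_leS kl); apply: card_le_trans h.
  by apply/card_le_funT; exists (existT F l) => x y; exact: (@existT_inj2 K F l).
move=> /card_le_funT[f finj]; exists (fun a => projT1 (f a)) => k.
apply: (@card_le_trans _ _ _ (existT F k @` [set: F k])); last exact: card_image_le.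
apply: (inj_card_le_fun (f := f)) => [a <-|a b _ _ /finj//].
by exists (projT2 (f a)) => //; case: (f a).
Qed.

End Aleph.

(** * The Cantor cube and the compactified discrete space *)

(** The index type is turned into a choice type because the theory of products
    requires decidable equality of indices. *)
Definition cantor_cube (A : Type) : topologicalType :=
  prod_topology (fun _ : {classic A} => bool).

Lemma cantor_cube_compact (A : Type) : compact [set: cantor_cube A].
Proof.
have := @tychonoff {classic A} (fun=> bool) (fun=> setT) (fun=> bool_compact).
by congr compact; apply/seteqP; split.
Qed.

Lemma cantor_cube_hausdorff (A : Type) : hausdorff_space (cantor_cube A).
Proof.
apply: (@hausdorff_product {classic A} (fun=> bool)) => _.
exact: discrete_hausdorff.
Qed.

Lemma cantor_cube_open_basic (A : Type) (U : set (cantor_cube A)) (x : cantor_cube A) :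
  open U -> U x -> exists D : seq {classic A},
    forall y : cantor_cube A, (forall a, a \in D -> y a = x a) -> U y.
Proof.
move=> Uo Ux.
pose cyl (D : seq {classic A}) : set (cantor_cube A) :=
  [set y | forall a, a \in D -> y a = x a].
pose Fx := filter_from setT cyl.
have Ffilt : Filter Fx.
  apply: filter_from_filter; first by exists [::].
  move=> D E _ _; exists (D ++ E) => // y yDE.
  by split=> a aD; apply: yDE; rewrite mem_cat aD ?orbT.
(* Convergence in a product is tested on coordinates, so the filter generated
   by the cylinders converges to [x]. *)
suff /(_ U (open_nbhs_nbhs (conj Uo Ux))) [D _ DU] : Fx --> x by exists D.
apply/cvg_sup => a V [W [[B _ <-] /= xB] WV].
exists [:: a] => // y /(_ a (mem_head _ _)) yx; apply: WV => /=.
by rewrite yx.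
Qed.

Lemma card_powerset_le_cantor_cube (A : Type) :
  [set: set A] #<= [set: cantor_cube A].
Proof.
apply/card_le_funT.
exists (fun (S : set A) (a : A) => `[< S a >]) => S S' SS; apply/funext => a.
by apply: propext; exact: (asbool_eq_equiv (congr1 (fun h => h a) SS)).
Qed.

(** An open set is the union of the cylinders it contains. *)
Lemma card_cantor_cube_opens (A : Type) : infinite_type A ->
  opens (cantor_cube A) #<= [set: set A].
Proof.
move=> Ainf.
have seq_le : [set: seq ({classic A} * bool)] #<= [set: A].
  have AB : [set: {classic A} * bool] #<= [set: A].
    apply: card_prod_le => //.
    exact/card_finite_le/finite_finset.
  have ABinf : infinite_type ({classic A} * bool).
    apply: infinite_type_le Ainf _; apply/card_le_funT.
    by exists (fun a => (a, true)) => a b [].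
  exact: card_le_trans (card_seq_le ABinf) AB.
apply: card_le_trans (card_powerset_le seq_le).
pose cyl (p : seq ({classic A} * bool)) : set (cantor_cube A) :=
  [set y | forall a b, (a, b) \in p -> y a = b].
apply: (inj_card_le_fun (f := fun U => [set p | cyl p `<=` U])) => // U V Uo Vo.
have sub (W W' : set (cantor_cube A)) : open W ->
    [set p | cyl p `<=` W] = [set p | cyl p `<=` W'] -> W `<=` W'.
  move=> Wo WW' x Wx; have [D DW] := cantor_cube_open_basic Wo Wx.
  pose p := [seq (a, x a) | a <- D].
  have : [set p | cyl p `<=` W] p.
    by move=> y yp; apply: DW => a aD; apply: yp; exact: map_f.
  by rewrite WW'; apply => a b /mapP[c _ [-> ->]].
by move=> UV; apply/seteqP; split; exact: sub.
Qed.

Lemma opc_discrete_open_some (K : choiceType) (S : set K) :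
  @open (one_point_compactification (discrete_topology K)) (some @` S).
Proof. exact/one_point_compactification_open_some/discrete_open. Qed.

Lemma opc_discrete_hausdorff (K : choiceType) :
  hausdorff_space (one_point_compactification (discrete_topology K)).
Proof.
have sep (k : K) : @open (one_point_compactification (discrete_topology K))
    (~` [set Some k]).
  rewrite openE => -[l /= lk|_]; rewrite /interior.
    rewrite nbhsE; exists (some @` (~` [set k])); last by move=> _ [m mk <-] [/mk].
    split; first exact: opc_discrete_open_some.
    by exists l => // lk'; apply: lk; rewrite lk'.
  exists [set k]; first by split; [exact: compact_set1|exact: discrete_closed].
  by move=> _ [[m mk <-] [/mk]|->].
have single (k : K) : @open (one_point_compactification (discrete_topology K))
    [set Some k].
  by rewrite -image_set1; exact: opc_discrete_open_some.
rewrite open_hausdorff => -[k|] [l|]//.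
- move=> kl; exists ([set Some k], ~` [set Some k]) => /=.
    by split; rewrite inE //= => lk; move: kl; rewrite lk eqxx.
  by split=> //; rewrite setICr.
- move=> kl; exists ([set Some k], ~` [set Some k]) => /=; first by split; rewrite inE.
  by split=> //; rewrite setICr.
- move=> kl; exists (~` [set Some l], [set Some l]) => /=; first by split; rewrite inE.
  by split=> //; rewrite setICl.
Qed.

(** * Disjoint sums of spaces *)

Lemma sigT_hausdorff (I : choiceType) (X : I -> topologicalType) :
  (forall i, hausdorff_space (X i)) -> hausdorff_space {i & X i}.
Proof.
move=> Xhaus; rewrite open_hausdorff => -[i x] [j y].
have [eij|ij xy] := eqVneq i j.
  subst j => xy; have {}xy : x != y by apply: contra_neq xy => ->.
  have := Xhaus i; rewrite open_hausdorff => /(_ x y xy)[[U V] /= [Ux Vy] [Uo Vo UV]].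
  exists (existT X i @` U, existT X i @` V) => /=.
    by split; apply/mem_set; [exists x|exists y] => //; apply/set_mem.
  split; [exact: existT_open_map|exact: existT_open_map|].
  apply/eqP/seteqP; split=> // _ [[u Uu <-] [v Vv vu]].
  have : (U `&` V) u by split; rewrite // -(existT_inj2 vu).
  by rewrite (eqP UV).
exists (existT X i @` setT, existT X j @` setT) => /=.
  by split; apply/mem_set; [exists x|exists y].
split; [exact/existT_open_map/openT|exact/existT_open_map/openT|].
apply/eqP/seteqP; split=> // _ [[u _ <-] [v _ vu]].
have ji : j = i := congr1 (@projT1 _ _) vu.
by rewrite ji eqxx in ij.
Qed.

(** The sum of two spaces, as the instance of the dependent sum topology with
    two summands. *)
Definition sum_space (Y Z : topologicalType) : topologicalType :=
  {b : bool & (fun b => if b then Y else Z) b}.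

Definition suml (Y Z : topologicalType) (y : Y) : sum_space Y Z :=
  existT (fun b : bool => if b then Y else Z : Type) true y.
Definition sumr (Y Z : topologicalType) (z : Z) : sum_space Y Z :=
  existT (fun b : bool => if b then Y else Z : Type) false z.

Lemma sum_openP (Y Z : topologicalType) (U : set (sum_space Y Z)) :
  open U <-> open (@suml Y Z @^-1` U) /\ open (@sumr Y Z @^-1` U).
Proof.
split=> [/sigT_openP Uo|[Ul Ur]]; first by split; [exact: (Uo true)|exact: (Uo false)].
by apply/sigT_openP => -[].
Qed.

Lemma suml_open (Y Z : topologicalType) (U : set Y) : open U ->
  open (@suml Y Z @` U).
Proof. exact: (@existT_open_map _ (fun b : bool => if b then Y else Z) true). Qed.

Lemma suml_inj (Y Z : topologicalType) : injective (@suml Y Z).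
Proof. by move=> y y' yy; exact: existT_inj2 yy. Qed.

Lemma sumr_inj (Y Z : topologicalType) : injective (@sumr Y Z).
Proof. by move=> z z' zz; exact: existT_inj2 zz. Qed.

Lemma sum_space_compact (Y Z : topologicalType) :
  compact [set: Y] -> compact [set: Z] -> compact [set: sum_space Y Z].
Proof.
by move=> Yc Zc; apply: sigT_compact => [|[]//]; exact: finite_finset.
Qed.

Lemma sum_space_hausdorff (Y Z : topologicalType) :
  hausdorff_space Y -> hausdorff_space Z -> hausdorff_space (sum_space Y Z).
Proof. by move=> Yh Zh; apply: sigT_hausdorff => -[]. Qed.

Lemma card_sum_space_opens_le (Y Z : topologicalType) (M : Type) : infinite_type M ->
  opens Y #<= [set: M] -> opens Z #<= [set: M] -> opens (sum_space Y Z) #<= [set: M].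
Proof.
move=> Minf YM ZM; have [m _] := infinite_setN0 Minf.
have [f _ finj] := card_le_fun m YM; have [g _ ginj] := card_le_fun m ZM.
apply: card_le_trans (card_square_le Minf).
apply: (inj_card_le_fun
  (f := fun U => (f (@suml Y Z @^-1` U), g (@sumr Y Z @^-1` U)))) => //.
move=> U V /sum_openP[Ul Ur] /sum_openP[Vl Vr].
move=> [/(finj _ _ Ul Vl) el /(ginj _ _ Ur Vr) er].
apply/seteqP; split=> -[[] x] h.
- by have : (@suml Y Z @^-1` V) x by rewrite -el.
- by have : (@sumr Y Z @^-1` V) x by rewrite -er.
- by have : (@suml Y Z @^-1` U) x by rewrite el.
- by have : (@sumr Y Z @^-1` U) x by rewrite er.
Qed.

(** Points are closed, so complements of points are distinct open sets. *)
Lemma card_le_opens (X : topologicalType) : hausdorff_space X ->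
  [set: X] #<= opens X.
Proof.
move=> Xh; apply: (inj_card_le_fun (f := fun x => ~` [set x])).
  by move=> x _; apply: closed_openC; exact/accessible_closed_set1/hausdorff_accessible.
by move=> x y _ _ /(congr1 (@setC X)); rewrite !setCK => /seteqP[/(_ x erefl)].
Qed.

(** * Calibers at the aleph *)

Section AlephCaliber.
Context (d : Order.disp_t) (K : orderType d) (F : K -> Type) (A : Type) (C : set K).
Hypotheses (K_card : initial_ordinal K) (K_infinite : infinite_type K).
Hypothesis F_aleph : forall k, least_infinite_above [set l : K | (l < k)%O] F (F k).
Hypothesis A_aleph : least_infinite_above [set: K] F A.
Hypothesis K_small : card_lt [set: K] [set: A].
Hypotheses (C_cof : is_cofinality C) (cof_gt : card_lt [set: nat] C).

(** The family is indexed: repetitions among the [U i] are counted, as they have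
    to be for traces of distinct open sets of a larger space. The size of a
    family is measured by comparison with all [F k] because this is what the
    smallness ideals control. *)
Lemma cantor_cube_common_point (I : Type) (S : set I) (U : I -> set (cantor_cube A)) :
  (forall i, S i -> nonempty_opens (cantor_cube A) (U i)) ->
  (forall k, ~ (S #<= [set: F k])) ->
  exists J, [/\ J `<=` S, forall k, ~ (J #<= [set: F k]) &
    exists y, forall i, J i -> U i y].
Proof.
move=> US Sbig.
have [k0 Kk0] := card_lt_aleph K_infinite F_aleph A_aleph K_small.
have [T Tcof Tthin] := exists_thin_cofinal K_card K_infinite C_cof.
have [D DP] : exists D : I -> cantor_cube A * seq {classic A}, forall i, S i ->
    forall y : cantor_cube A, (forall a, a \in (D i).2 -> y a = (D i).1 a) -> U i y.
  apply: (@choice_on I (cantor_cube A * seq {classic A}) ((fun=> true), [::]) S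
    (fun i D => forall y : cantor_cube A,
      (forall a, a \in D.2 -> y a = D.1 a) -> U i y)).
  move=> i /US[Uo [x Ux]]; have [D DU] := cantor_cube_open_basic Uo Ux.
  by exists (x, D).
have [] := @exists_agreeing_singular _ K F k0 T I {classic A}
  (fun i => (D i).1) (fun i => (D i).2) S (aleph_infinite F_aleph) _ Kk0
  (not_cofinal_sigma_ideal K_infinite C_cof cof_gt) Tcof _ Sbig.
- by move=> k l; exact: aleph_le.
- by move=> J G JT /(Tthin _ JT); exact: not_cofinal_bigcup.
move=> J [JS Jbig Jag]; exists J; split=> //.
have [i0 _] : J !=set0.
  apply/set0P/eqP => J0; apply: (Jbig k0); rewrite J0; exact: card_ge0.
have [f fP] := @choice_on A I i0
  [set a | exists2 i, J i & (a : {classic A}) \in (D i).2]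
  (fun a i => J i /\ (a : {classic A}) \in (D i).2)
  (fun a h => let: ex_intro2 i Ji ai := h in ex_intro _ i (conj Ji ai)).
(* The union of the compatible partial functions; [f a] is some member of [J]
   that is defined at [a]. *)
exists (fun a => (D (f a)).1 a) => i Ji; apply: DP => [|a ai]; first exact: JS.
have [|Jf af] := fP a; first by exists i.
exact: Jag.
Qed.

(** An open set missing the cube is determined by its trace on [Y], and there are
    too few traces for such sets to matter. *)
Lemma sum_cantor_cube_caliber_star (Y : topologicalType) :
  card_lt [set: set Y] [set: A] ->
  caliber_star (sum_space Y (cantor_cube A)) A.
Proof.
move=> Ysmall; split; first by have [] := A_aleph.
move=> G Gopen /card_eqPle[GA AG].
have [k1 Yk1] := card_lt_aleph K_infinite F_aleph A_aleph Ysmall.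
pose tr (U : set (sum_space Y (cantor_cube A))) := @sumr Y (cantor_cube A) @^-1` U.
pose S := [set U | G U /\ tr U !=set0].
have [|k Sk|J [JS Jbig [y Jy]]] := @cantor_cube_common_point _ S tr.
- by move=> U [/Gopen[/sum_openP[_ Uo] _] Une].
- pose l := Order.max k k1.
  have Finf : infinite_type (F l) by exact: aleph_infinite.
  apply: (aleph_not_le A_aleph (k := l)); apply: card_le_trans AG _.
  rewrite (_ : G = S `|` [set U | G U /\ ~ (tr U !=set0)]); last first.
    apply/seteqP; split=> U; last by case=> -[].
    by move=> GU; have [?|?] := pselect (tr U !=set0); [left|right].
  apply: card_setU_le => //.
    by apply: card_le_trans Sk (aleph_le F_aleph _); rewrite le_max lexx.
  apply: (@card_le_trans _ _ _ [set: set Y]); last first.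
    by apply: card_le_trans Yk1 (aleph_le F_aleph _); rewrite le_max lexx orbT.
  apply: (inj_card_le_fun (f := fun U => @suml Y (cantor_cube A) @^-1` U)) => //.
  move=> U V [_ trU] [_ trV] UV; apply/seteqP; split=> -[[] x] h.
  + by have : (@suml Y (cantor_cube A) @^-1` V) x by rewrite -UV.
  + by case: trU; exists x.
  + by have : (@suml Y (cantor_cube A) @^-1` U) x by rewrite UV.
  + by case: trV; exists x.
exists J; split.
- by move=> U /JS[].
- apply/card_eqPle; split; last exact: aleph_limit K_infinite F_aleph A_aleph _ _ Jbig.
  by apply: card_le_trans GA; apply: subset_card_le => U /JS[].
- by exists (sumr _ y) => U /Jy.
Qed.

(** Repeat [V k] along a fiber of size at most [F k]: a linked subfamily uses a
    single [V k], so it is no larger than that fiber. *)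
Lemma not_weak_precaliber_cellular (X : topologicalType) (V : K -> set X) :
  (forall k, nonempty_opens X (V k)) ->
  (forall k l, V k `&` V l !=set0 -> k = l) ->
  ~ weak_precaliber X A.
Proof.
move=> Vopen Vdisj [_ wp].
have [g gsmall] := exists_small_fibers K_card K_infinite F_aleph A_aleph.
have [J /card_eqPle[_ AJ] Jlinked] := wp (V \o g) (fun a => Vopen (g a)).
have [k0 _] := infinite_setN0 K_infinite.
have [a Ja] : J !=set0.
  apply/set0P/eqP => J0; apply: (aleph_not_le A_aleph (k := k0)).
  apply: card_le_trans AJ _; rewrite J0; exact: card_ge0.
apply: (aleph_not_le A_aleph (k := g a)); apply: card_le_trans (gsmall (g a)).
apply: card_le_trans AJ _; apply: subset_card_le => b Jb /=.
by apply: Vdisj; apply: Jlinked; [exists b|exists a].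
Qed.

Lemma not_weak_precaliber_star_cellular (X : topologicalType) (V : K -> set X) :
  (forall k, nonempty_opens X (V k)) ->
  (forall k l, V k `&` V l !=set0 -> k = l) ->
  ~ weak_precaliber_star X K.
Proof.
move=> Vopen Vdisj [_ wp].
have [||H [HV /card_eqPle[_ KH] Hlinked]] := wp (range V).
- by move=> _ [k _ <-].
- apply: inj_card_eq => k l _ _ kl; apply: Vdisj; rewrite kl setIid.
  by have [] := Vopen l.
apply: K_infinite; apply: card_le_finite KH _.
have [[U HU]|H0] := pselect (H !=set0); last first.
  by rewrite (_ : H = set0) //; apply/seteqP; split=> // U HU; apply: H0; exists U.
apply: sub_finite_set (finite_set1 U) => W HW.
have [k _ kU] := HV _ HU; have [l _ lW] := HV _ HW.
by rewrite -kU -lW /=; congr V; apply: Vdisj; rewrite kU lW; exact: Hlinked.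
Qed.

End AlephCaliber.

(** * The theorem *)

Theorem theorem3p20 (d : Order.disp_t) (K : orderType d) (A : Type)
    (C : set K)
    (K_card : initial_ordinal K)
    (K_infinite : infinite_type K)
    (A_aleph : is_aleph K A)
    (pow_lt : card_lt [set: set K] [set: A])
    (C_cof : is_cofinality C)
    (cof_gt : card_lt [set: nat] C) :
  exists X : topologicalType,
    [/\ compact [set: X] /\ hausdorff_space X,
        opens X #= [set: set A] /\ [set: X] #= [set: set A],
        caliber_star X A,
        ~ weak_precaliber X A &
        ~ weak_precaliber_star X K].
Proof.
have [F [F_aleph A_least]] := A_aleph.
have A_inf : infinite_type A by have [] := A_least.
have PA_inf := infinite_powerset A_inf.
have K_le_PK : [set: K] #<= [set: set K].
  by apply/card_le_funT; exists set1 => k l /seteqP[/(_ k erefl)].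
have K_lt : card_lt [set: K] [set: A].
  by apply/card_ltP => AK; case: pow_lt => _; apply; exact: card_le_trans AK K_le_PK.
pose Y := one_point_compactification (discrete_topology K) : topologicalType.
have Y_le : [set: Y] #<= [set: K] := card_option_le K_infinite.
have PY_lt : card_lt [set: set Y] [set: A].
  apply/card_ltP => AY; case: pow_lt => _; apply; apply: card_le_trans AY _.
  exact: card_powerset_le.
pose X := sum_space Y (cantor_cube A).
have X_haus : hausdorff_space X.
  apply: sum_space_hausdorff.
    exact: opc_discrete_hausdorff.
  exact: cantor_cube_hausdorff.
have PA_le_X : [set: set A] #<= [set: X].
  apply: card_le_trans (card_powerset_le_cantor_cube A) _.
  by apply/card_le_funT; exists (@sumr Y (cantor_cube A)); exact: sumr_inj.
have opens_le : opens X #<= [set: set A].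
  apply: card_sum_space_opens_le => //; last exact: card_cantor_cube_opens.
  apply: card_le_trans (card_leT _) _; apply: (card_le_trans PY_lt.1).
  by apply/card_le_funT; exists set1 => a b /seteqP[/(_ a erefl)].
have X_le_opens := card_le_opens X_haus.
pose V (k : K) : set X := @suml Y (cantor_cube A) @` (some @` [set k]).
have Vopen k : nonempty_opens X (V k).
  split; first exact/suml_open/opc_discrete_open_some.
  by exists (@suml Y _ (Some k)); exists (Some k) => //; exists k.
have Vdisj k l : V k `&` V l !=set0 -> k = l.
  by move=> [_ [[_ [_ -> <-] <-] [_ [_ -> <-] /suml_inj[]]]].
exists X; split.
- split=> //; apply: sum_space_compact; last exact: cantor_cube_compact.
  exact: one_point_compactification_compact.
- split; apply/card_eqPle; split=> //.
    exact: card_le_trans PA_le_X X_le_opens.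
  exact: card_le_trans X_le_opens opens_le.
- exact: sum_cantor_cube_caliber_star K_card K_infinite F_aleph A_least K_lt
    C_cof cof_gt _ PY_lt.
- exact: not_weak_precaliber_cellular K_card K_infinite F_aleph A_least _ _ Vopen Vdisj.
- exact: not_weak_precaliber_star_cellular K_infinite _ _ Vopen Vdisj.
Qed.
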